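(* Let $n \ge 1$ be an integer and let $X_{n,n}$ be the average optimal matching distance of the balanced random bipartite matching problem on the lattice $\{\tfrac{i}{2n+1} : i=1,\dots,2n\}\subset[0,1]$ with $n$ demand points and $n$ supply points. Then $$\mathbb{E}[X_{n,n}] = \frac{1}{2n+1}\cdot\frac{2^{2n-1}}{\binom{2n}{n}},$$ and, as $n\to\infty$, $$\mathbb{E}[X_{n,n}] \sim \frac14\sqrt{\frac{\pi}{n}}$$ (the ratio of the two sides tends to $1$).
   Context: The lattice problem: let $l = \frac{1}{2n+1}$ and consider the $2n$ positions $x_i = i\,l$, $i=1,\dots,2n$. A set $U$ of $n$ demand points and a set $V$ of $n$ supply points are randomly mixed and assigned to these positions, one point per position; i.e. the set of positions occupied by $U$ is a uniformly random $n$-element subset of the $2n$ positions, and $V$ occupies the rest. The random variable $X_{n,n}$ is $\frac1n$ times the minimum of $\sum_{u\in U} |x_u - x_{\sigma(u)}|$ over all bijections $\sigma: U\to V$, where $x_p$ denotes the coordinate of the point $p$. *)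

(* Defs.v *)
From HB Require Import structures.
From mathcomp Require Import all_boot all_order all_algebra.
From mathcomp Require Import all_classical all_reals all_analysis.

Set Implicit Arguments.
Unset Strict Implicit.
Unset Printing Implicit Defensive.

Import Order.TTheory GRing.Theory Num.Theory.

Local Open Scope classical_set_scope.
Local Open Scope ring_scope.

(* The ordinal i : 'I_(2 * n), numbered from 0, stands for the site x_(i+1). *)
Definition site (R : realType) (n : nat) (i : 'I_(2 * n)) : R :=
  i.+1%:R / (2 * n + 1)%:R.

Definition matching_cost (R : realType) (n : nat) (U : {set 'I_(2 * n)})
    (s : 'I_(2 * n) -> 'I_(2 * n)) : R :=
  \sum_(u in U) `|site R u - site R (s u)|.

(* A bijection from U onto its complement is a total function on the sites of
   which only the restriction to U matters.  When #|U| = n the set of costs is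
   finite and nonempty, so that its infimum is a minimum. *)
Definition avg_optimal_matching (R : realType) (n : nat)
    (U : {set 'I_(2 * n)}) : R :=
  n%:R^-1 * inf (matching_cost R U @` [set s | set_bij [set` U] [set` ~: U] s]).

(* The event "U = A" has probability 1 / 'C(2 * n, n) for each n-subset A; these
   values sum to 1, so the subsets of any other cardinality have probability 0. *)
Definition uniform_n_subset (R : realType) (n : nat) (d : measure_display)
    (T : measurableType d) (P : probability T R)
    (U : T -> {set 'I_(2 * n)}) : Prop :=
  (forall A : {set 'I_(2 * n)}, measurable (U @^-1` [set A])) /\
  (forall A : {set 'I_(2 * n)}, #|A| = n ->
     P (U @^-1` [set A]) = ('C(2 * n, n)%:R^-1)%:E).

(* Main.v *)
Require Import Defs.
From HB Require Import structures.
From mathcomp Require Import all_boot all_order all_algebra.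
From mathcomp Require Import all_classical all_reals all_analysis.
From mathcomp Require Import measurable_realfun.
From mathcomp Require Import zify ring lra.
Import Order.TTheory GRing.Theory Num.Theory.
Import numFieldNormedType.Exports.

(** Cut the line at each of the 2n sites.  A matching sends across a cut at
    least as many pairs as the imbalance between demand and supply points to
    the left of it, and the matching that pairs the i-th demand point with the
    i-th supply point attains this bound at every cut simultaneously
    ([matching_cost_lower], [sorted_matching]).  Hence the optimal cost is the
    sum of these imbalances times the mesh 1 / (2n + 1), that is, the absolute
    area under a +1/-1 bridge of length 2n, and the expectation is an average
    of that area over all n-subsets.

    The imbalance at a given cut, summed over all n-subsets, is a sum over the
    number of demand points to the left of the cut of a linear weight times
    two binomial coefficients.  This hypergeometric sum telescopes
    ([central_telescope]) to a constant times a product of two terms of the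
    form (2m + 1) 'C(2m, m).  These are the coefficients of
    (1 - 4x)^(-3/2), so that summing over the cuts amounts to reading off
    coefficients of (1 - 4x)^(-3); this is done by a recurrence
    ([conv_wbin]).  The total area over all n-subsets is n 4^n / 2
    ([sum_gap_chain]), which gives the exact formula.

    For the asymptotics, the expectation is half the Wallis integral of
    sin^(2n+1) over [0, pi/2] ([expected_matching_sinint]).  The products of
    consecutive Wallis integrals are explicit and the integrals decrease, so
    the square of this one lies between pi / (4n + 4) and pi / (4n + 2), and
    the ratio in the theorem lies between n / (n + 1) and 1
    ([wallis_ratio_bounds]). *)

Local Open Scope nat_scope.

(** * Binomial sums *)

(** Let a, b', c, d be the numbers of demand and supply points to the left of
    a cut, then to the right of it.  As a + c = b' + d = n, one has
    n (a - b') = a d - b' c, and the two products turn the summand into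
    G_i - G_(i+1) with
    G_i = (m + b + i) (q + b + i) 'C(2m + b, m + b + i) 'C(2q + b, q + b + i).
    For the cut at 2m + b these numbers are a = m + b + i, b' = m - i,
    c = q - i, d = q + b + i; the lemma is used with b the parity of the
    cut. *)
Lemma central_telescope (b m q N : nat) :
  (m + q + b) * (\sum_(i < N) (i.*2 + b) *
      ('C(m.*2 + b, m + b + i) * 'C(q.*2 + b, q + b + i))) +
    (m + b + N) * (q + b + N) *
      ('C(m.*2 + b, m + b + N) * 'C(q.*2 + b, q + b + N)) =
  (m + b) * (q + b) * ('C(m.*2 + b, m + b) * 'C(q.*2 + b, q + b)).
Proof.
elim: N => [|N IHN]; first by rewrite big_ord0 muln0 add0n !addn0.
rewrite -{}IHN big_ord_recr /= mulnDr -addnA; congr (_ + _).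
rewrite !addnS.
have Em := mul_bin_left (m.*2 + b) (m + b + N).
have Eq := mul_bin_left (q.*2 + b) (q + b + N).
have -> : (m + b + N).+1 * (q + b + N).+1 *
   ('C(m.*2 + b, (m + b + N).+1) * 'C(q.*2 + b, (q + b + N).+1)) =
   (m - N) * (q - N) * ('C(m.*2 + b, m + b + N) * 'C(q.*2 + b, q + b + N)).
  rewrite mulnACA Em Eq mulnACA; congr (_ * _ * _); lia.
have [ltmN|leNm] := ltnP m N.
  by rewrite (@bin_small (m.*2 + b)) ?mul0n ?muln0 //; lia.
have [ltqN|leNq] := ltnP q N.
  by rewrite (@bin_small (q.*2 + b)) ?mul0n ?muln0 //; lia.
rewrite mulnA -mulnDl; congr (_ * _).
rewrite -(subnKC leNm) -(subnKC leNq) !addKn -!mul2n; ring.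
Qed.

(** The hypothesis says that the generating series f of u satisfies
    f' (1 - 4x) = al f; the conclusion says the same for f^2, with 2 al. *)
Lemma conv_recurrence {u : nat -> nat} {al : nat} :
  (forall m, m.+1 * u m.+1 = (4 * m + al) * u m) ->
  forall n, n.+1 * (\sum_(i < n.+2) u i * u (n.+1 - i)) =
            (4 * n + 2 * al) * (\sum_(i < n.+1) u i * u (n - i)).
Proof.
move=> uS n.
(* By symmetry the mean index in a convolution of u with itself is n / 2. *)
have half N : N * (\sum_(i < N.+1) u i * u (N - i)) =
    2 * \sum_(i < N.+1) i * (u i * u (N - i)).
  rewrite mul2n -addnn [X in _ = X + _](reindex_inj rev_ord_inj) -big_split big_distrr /=.
  apply: eq_bigr => i _; rewrite subSS subKn; last by rewrite -ltnS.
  by rewrite [u (N - i) * u i]mulnC -mulnDl subnK -1?ltnS.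
rewrite half big_ord_recl mul0n add0n mulnDl -[4]/(2 * 2) -!mulnA half.
rewrite -mulnDr; congr (2 * _).
rewrite !big_distrr -big_split /=; apply: eq_bigr => i _.
rewrite /bump /= add1n subSS mulnA uS; ring.
Qed.

(** The coefficient of x^m in (1 - 4x)^(-3/2). *)
Definition wbin (m : nat) : nat := (m.*2).+1 * 'C(m.*2, m).

(** The factors that [central_telescope] leaves at the odd and even cuts. *)
Lemma wbin_odd (m : nat) : m.+1 * 'C(m.*2.+1, m.+1) = wbin m.
Proof. by rewrite -mul_bin_diag. Qed.

Lemma wbin_even (m : nat) : m.+1 * 'C(m.+1.*2, m.+1) = 2 * wbin m.
Proof.
rewrite -mul_bin_diag doubleS /= -[X in 'C(_, X)](_ : m.*2.+1 - m.+1 = m).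
  by rewrite bin_sub -addnn ?ltnS ?leq_addl // -wbin_odd -addnn; ring.
by rewrite -addnn; lia.
Qed.

Lemma wbinS (m : nat) : m.+1 * wbin m.+1 = (4 * m + 6) * wbin m.
Proof.
by rewrite {1}/wbin mulnCA wbin_even -!mul2n; ring.
Qed.

(** The coefficients of (1 - 4x)^(-3). *)
Lemma conv_wbin (n : nat) :
  2 * \sum_(i < n.+1) wbin i * wbin (n - i) = 4 ^ n * (n.+1 * n.+2).
Proof.
elim: n => [|n IHn]; first by rewrite big_ord_recl big_ord0.
apply/eqP; rewrite -(eqn_pmul2l (ltn0Sn n)) mulnCA (conv_recurrence wbinS).
rewrite mulnCA IHn expnS; apply/eqP; ring.
Qed.

(** * The total area under balanced paths *)

(** An n-subset with a elements in B is a pair of an a-subset of B and an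
    (n - a)-subset of the complement of B. *)
Lemma card_draws_inter {T : finType} (B : {set T}) (n a : nat) : a <= n ->
  #|[set A : {set T} | (#|A| == n) && (#|A :&: B| == a)]| =
  'C(#|B|, a) * 'C(#|~: B|, n - a).
Proof.
move=> le_an.
rewrite -!cards_draws -cardsX.
pose split_at (A : {set T}) := (A :&: B, A :\: B).
rewrite -(@card_in_imset _ _ split_at); last first.
  by move=> A A' _ _ [] eI eD; rewrite -(setID A B) eI eD setID.
congr #|pred_of_set _|; apply/setP => -[X Y]; rewrite !inE /=.
apply/idP/idP => [/imsetP[A] | /andP[/andP[sXB /eqP cX] /andP[sYB /eqP cY]]].
  rewrite inE => /andP[/eqP cA /eqP cAB] [-> ->].
  rewrite subsetIr cAB eqxx subDset finset.setUCr finset.subsetT /=.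
  by rewrite -(addKn a #|A :\: B|) -cAB cardsID cA cAB.
have YB0 : Y :&: B = finset.set0.
  by apply: disjoint_setI0; rewrite finset.disjoints_subset.
have cXY : #|X :|: Y| = n.
  suff XY0 : X :&: Y = finset.set0 by rewrite cardsU XY0 cards0 cX cY subn0 subnKC.
  apply: disjoint_setI0; rewrite disjoint_sym finset.disjoints_subset.
  by rewrite (fintype.subset_trans sYB) // finset.setCS.
apply/imsetP; exists (X :|: Y).
  by rewrite inE cXY finset.setIUl YB0 finset.setU0 (finset.setIidPl sXB) cX !eqxx.
rewrite /split_at finset.setIUl YB0 finset.setU0 (finset.setIidPl sXB).
rewrite finset.setDUl (eqP (_ : X :\: B == finset.set0)) ?finset.setD_eq0 //.
by rewrite finset.set0U (finset.setDidPl _) // finset.disjoints_subset.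
Qed.

Lemma sum_draws_inter {T : finType} (B : {set T}) (n : nat) (f : nat -> nat) :
  \sum_(A : {set T} | #|A| == n) f #|A :&: B| =
  \sum_(a < n.+1) f a * ('C(#|B|, a) * 'C(#|~: B|, n - a)).
Proof.
rewrite (partition_big (fun A : {set T} => inord #|A :&: B| : 'I_n.+1) xpredT) //=.
apply: eq_bigr => a _; rewrite -card_draws_inter -1?ltnS // mulnC.
rewrite -sum_nat_const; apply: congr_big => // A.
  rewrite inE; case: eqP => //= cA.
  by rewrite -val_eqE /= inordK // ltnS -cA subset_leq_card ?finset.subsetIl.
case/andP=> /eqP cA /eqP <-; rewrite inordK // ltnS -cA.
by rewrite subset_leq_card ?finset.subsetIl.
Qed.

(** The absolute difference; it is split into two truncated differences
    because complementation of a subset exchanges them. *)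
Definition gap (x y : nat) : nat := (x - y) + (y - x).

(** Complementation reduces the sum of the gaps to twice the sum of the
    truncated differences #|A :&: B| - #|~: A :&: B|.  As b is at most 1,
    these vanish when #|A :&: B| < m + b, and [central_telescope] sums the
    others. *)
Lemma sum_gap_draws {T : finType} (B : {set T}) (b m q : nat) :
  b <= 1 -> #|B| = m.*2 + b -> #|~: B| = q.*2 + b ->
  (m + q + b) * \sum_(A : {set T} | #|A| == m + q + b)
      gap #|A :&: B| #|~: A :&: B| =
  2 * ((m + b) * (q + b) * ('C(m.*2 + b, m + b) * 'C(q.*2 + b, q + b))).
Proof.
set n := m + q + b => b1 cB cBc.
have cT : #|T| = n.*2 by rewrite -(cardsC B) cB cBc /n -!addnn; lia.
have cAB (A : {set T}) : #|~: A :&: B| = #|B| - #|A :&: B|.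
  rewrite -(cardsID A B) [A :&: B]finset.setIC addKn.
  by rewrite finset.setDE finset.setIC.
rewrite big_split /= [X in _ + X](reindex_inj (@finset.setC_inj T)) /=.
rewrite [X in _ + X](eq_big (fun A : {set T} => #|A| == n)
   (fun A => #|A :&: B| - #|~: A :&: B|)); first last.
- by move=> A _; rewrite finset.setCK.
- by move=> A; have := cardsC A; rewrite cT -addnn => cA; lia.
rewrite addnn -mul2n mulnCA; congr (2 * _).
under eq_bigr do rewrite cAB.
rewrite (sum_draws_inter B n (fun a => a - (#|B| - a))) cB cBc.
have -> : n.+1 = (m + b) + q.+1 by rewrite /n; lia.
rewrite big_split_ord /= big1 ?add0n => [|i _]; last first.
  by rewrite (_ : i - _ = 0) ?mul0n //; have := ltn_ord i; lia.
rewrite -(central_telescope b m q q.+1).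
rewrite (@bin_small (q.*2 + b) (q + b + q.+1)) ?muln0 ?addn0; last lia.
congr (_ * _); apply: eq_bigr => i _.
have [lt_mi|le_im] := ltnP m i.
  by rewrite (@bin_small (m.*2 + b) (m + b + i)) ?mul0n ?muln0 //; lia.
congr (_ * (_ * _)); first lia.
rewrite -bin_sub; last by have := ltn_ord i; lia.
by congr 'C(_, _); have := ltn_ord i; rewrite /n -addnn; lia.
Qed.

Lemma big_ord_double (n : nat) (g : nat -> nat) :
  \sum_(k < n.*2) g k = \sum_(m < n) g m.*2 + \sum_(m < n) g m.*2.+1.
Proof.
elim: n => [|n IHn]; first by rewrite !big_ord0.
by rewrite doubleS !big_ord_recr /= IHn -!addnA; congr (_ + _); rewrite addnCA.
Qed.

(** Multiplied by n = p + 1, the odd cuts contribute 2 wbin m wbin q with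
    m + q = p and the even ones 8 wbin m wbin q with m + q = p - 1; both
    families are convolutions evaluated by [conv_wbin]. *)
Lemma sum_gap_chain {T : finType} (B : nat -> {set T}) (n : nat) :
  #|T| = n.*2 -> (forall k, k < n.*2 -> #|B k| = k) -> 0 < n ->
  2 * \sum_(k < n.*2) \sum_(A : {set T} | #|A| == n)
    gap #|A :&: B k| #|~: A :&: B k| = n * 4 ^ n.
Proof.
case: n => [//|p] cT cB _.
pose g k := \sum_(A : {set T} | #|A| == p.+1) gap #|A :&: B k| #|~: A :&: B k|.
rewrite -[X in _ * X]/(\sum_(k < p.+1.*2) g k).
have cBc k : k < p.+1.*2 -> #|~: B k| = p.+1.*2 - k.
  by move=> lt_k; rewrite -cT -(cardsC (B k)) cB // addKn.
have godd m : m < p.+1 -> p.+1 * g m.*2.+1 = 2 * (wbin m * wbin (p - m)).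
  move=> lt_m; have := @sum_gap_draws T (B m.*2.+1) 1 m (p - m) isT.
  rewrite cB; last lia.
  rewrite cBc; last lia.
  rewrite addn1 (_ : m + (p - m) + 1 = p.+1); last lia.
  rewrite /g => ->; [|by []|by lia].
  by rewrite !addn1 mulnACA !wbin_odd.
have geven0 : g 0.*2 = 0.
  apply: big1 => A _; have /eqP := cB 0 isT; rewrite cards_eq0 => /eqP ->.
  by rewrite !finset.setI0 cards0.
have geven m : m < p -> p.+1 * g m.+1.*2 = 8 * (wbin m * wbin (p.-1 - m)).
  move=> lt_m; have := @sum_gap_draws T (B m.+1.*2) 0 m.+1 (p.-1 - m).+1 isT.
  rewrite cB; last lia.
  rewrite cBc; last lia.
  rewrite !addn0 (_ : m.+1 + (p.-1 - m).+1 = p.+1); last lia.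
  rewrite /g => ->; [|by []|by lia].
  rewrite mulnACA !wbin_even; ring.
apply/eqP; rewrite -(eqn_pmul2l (ltn0Sn p)); apply/eqP.
rewrite big_ord_double mulnCA mulnDr big_ord_recl geven0 add0n !big_distrr /=.
under eq_bigr => m _ do rewrite /bump /= add1n geven //.
under [X in _ * (_ + X)]eq_bigr => m _ do rewrite godd //.
rewrite -!big_distrr /= conv_wbin.
case: p {cT cB g cBc godd geven0 geven} => [|p]; first by rewrite big_ord0.
rewrite (_ : 8 = 4 * 2) // -mulnA conv_wbin !expnS; ring.
Qed.

(** * Optimal matchings on the line *)

Lemma gapC (x y : nat) : gap x y = gap y x.
Proof. exact: addnC. Qed.

Lemma sum_threshold_sub (N x y : nat) :
  \sum_(k < N) ((x < k) - (y < k)) = minn N.-1 y - x.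
Proof.
elim: N => [|N IHN]; first by rewrite big_ord0; lia.
by rewrite big_ord_recr /= IHN; case: (ltnP x N); case: (ltnP y N); lia.
Qed.

(** The distance between two sites is the number of cuts that separate them. *)
Lemma gap_thresholds {N x y : nat} : x < N -> y < N ->
  gap x y = \sum_(k < N) gap (x < k) (y < k).
Proof.
by move=> ltxN ltyN; rewrite big_split /= !sum_threshold_sub /gap; lia.
Qed.

Lemma leq_gap_sum {I : finType} (P : pred I) (x y : I -> nat) :
  gap (\sum_(i | P i) x i) (\sum_(i | P i) y i) <= \sum_(i | P i) gap (x i) (y i).
Proof.
elim/big_rec3: _ => [|i a b c _]; first by [].
rewrite /gap; lia.
Qed.

(** The triangle inequality is an equality when no two terms have opposite
    signs. *)
Lemma gap_sum_mono {I : finType} (P : pred I) (x y : I -> nat) :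
  (forall i, P i -> x i <= y i) ->
  \sum_(i | P i) gap (x i) (y i) = gap (\sum_(i | P i) x i) (\sum_(i | P i) y i).
Proof.
move=> le_xy; rewrite /gap big_split /= big1 => [|i /le_xy]; last first.
  by rewrite -subn_eq0 => /eqP.
rewrite sumnB //; have := leq_sum (index_enum I) le_xy.
by rewrite -subn_eq0 => /eqP ->.
Qed.

Definition below {N : nat} (k : nat) : {set 'I_N} := [set i : 'I_N | i < k].

Lemma card_below {N : nat} (k : nat) : k <= N -> #|@below N k| = k.
Proof.
move=> le_kN; rewrite -sum1_card -[RHS]card_ord -sum1_card.
rewrite (big_ord_widen N (fun=> 1) le_kN).
by apply: eq_bigl => i; rewrite inE.
Qed.

Lemma sum_below {N : nat} (A : {set 'I_N}) (k : nat) :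
  \sum_(i in A) (i < k) = #|A :&: below k|.
Proof.
by rewrite -sum1_card -big_mkcondr; apply: eq_bigl => i; rewrite !inE.
Qed.

Lemma sum_below_image {N : nat} {A B : {set 'I_N}} {s : 'I_N -> 'I_N} (k : nat) :
  {in A &, injective s} -> s @: A = B ->
  \sum_(i in A) (s i < k) = #|B :&: below k|.
Proof.
by move=> s_inj <-; rewrite -sum_below (big_imset (fun j : 'I_N => (j < k) : nat)).
Qed.

(** Exchange the sums over pairs and over cuts, and apply the triangle
    inequality at each cut. *)
Lemma matching_cost_lower {N : nat} (A B : {set 'I_N}) (s : 'I_N -> 'I_N) :
  {in A &, injective s} -> s @: A = B ->
  \sum_(k < N) gap #|A :&: below k| #|B :&: below k| <= \sum_(i in A) gap i (s i).
Proof.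
move=> s_inj sAB.
rewrite (eq_bigr _ (fun i _ => gap_thresholds (ltn_ord i) (ltn_ord (s i)))).
rewrite exchange_big; apply: leq_sum => k _.
by rewrite -sum_below -(sum_below_image k s_inj sAB) leq_gap_sum.
Qed.

(** The enumeration of A is increasing, so its elements below k come first. *)
Lemma nth_enum_below {N : nat} (A : {set 'I_N}) (x0 : 'I_N) (i k : nat) :
  i < #|A| -> (nth x0 (enum A) i < k) = (i < #|A :&: below k|).
Proof.
move=> ltiA; pose vs := map val (enum A).
have vs_sorted : sorted leq vs.
  apply: (subseq_sorted leq_trans _ (iota_sorted 0 N)).
  by rewrite -val_enum_ord enumT map_subseq // filter_subseq.
have count_vs : count (fun v => v < k) vs = #|A :&: below k|.
  rewrite /vs count_map -sum1_count big_enum_cond -sum1_card /=.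
  by apply: eq_bigl => j; rewrite !inE.
have size_vs : i < size vs by rewrite size_map -cardE.
rewrite -[X in X < _](nth_map x0 (val x0)) -?cardE // -/vs -count_vs.
apply/idP/idP => [|lti]; last exact: (@nth_count_lt _ nat).
apply: contraTT; rewrite -!leqNgt => gei.
by apply: (@nth_count_ge _ nat) => //; apply/andP.
Qed.

(** Pair the elements of A and B of equal rank.  At a cut k, the points of A
    on the left are those of rank less than #|A :&: below k|, and likewise for
    B, so that all the pairs separated by k cross it in the same direction and
    [gap_sum_mono] applies. *)
Lemma sorted_matching {N : nat} (A B : {set 'I_N}) : #|A| = #|B| ->
  exists s : 'I_N -> 'I_N, [/\ {in A &, injective s}, s @: A = B &
    \sum_(i in A) gap i (s i) =
    \sum_(k < N) gap #|A :&: below k| #|B :&: below k|].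
Proof.
move=> cAB; pose s (i : 'I_N) := nth i (enum B) (index i (enum A)).
have rank_lt i : i \in A -> index i (enum A) < #|A|.
  by rewrite cardE index_mem mem_enum.
have s_inj : {in A &, injective s}.
  move=> i j iA jA.
  rewrite /s [nth j _ _](set_nth_default i) -?cardE -?cAB ?rank_lt // => /eqP.
  rewrite nth_uniq ?enum_uniq -?cardE -?cAB ?rank_lt // => /eqP eij.
  by rewrite -(nth_index i (s := enum A) (x := i)) ?mem_enum // eij nth_index ?mem_enum.
have sAB : s @: A = B.
  apply/eqP; rewrite eqEcard card_in_imset // cAB leqnn andbT.
  apply/fintype.subsetP => _ /imsetP[i iA ->].
  by rewrite -mem_enum mem_nth // -cardE -cAB rank_lt.
exists s; split=> //.
rewrite (eq_bigr _ (fun i _ => gap_thresholds (ltn_ord i) (ltn_ord (s i)))).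
rewrite exchange_big; apply: eq_bigr => k _.
rewrite -sum_below -(sum_below_image k s_inj sAB).
have iE i : i \in A -> (i < k) = (index i (enum A) < #|A :&: below k|).
  move=> iA; rewrite -(nth_enum_below A i) ?rank_lt //.
  by rewrite nth_index ?mem_enum.
have sE i : i \in A -> (s i < k) = (index i (enum A) < #|B :&: below k|).
  by move=> iA; rewrite nth_enum_below -?cAB ?rank_lt.
have [le_c|/ltnW le_c] := leqP #|A :&: below k| #|B :&: below k|.
  apply: gap_sum_mono => i iA; rewrite (iE i) // sE //.
  by case: ltnP => // lt_i; rewrite (leq_trans lt_i).
rewrite gapC -gap_sum_mono => [|i iA]; first by apply: eq_bigr => i _; rewrite gapC.
rewrite (iE i) // sE //; by case: ltnP => // lt_i; rewrite (leq_trans lt_i).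
Qed.

Local Open Scope classical_set_scope.
Local Open Scope ring_scope.

Lemma site_dist {R : realType} {n : nat} (i j : 'I_(2 * n)) :
  `|site R i - site R j| = (gap i j)%:R / (2 * n + 1)%:R.
Proof.
rewrite /site -mulrBl normrM [X in _ * X]ger0_norm ?invr_ge0 ?ler0n //.
congr (_ / _); rewrite /gap; have [le_ij|lt_ji] := leqP i j.
  rewrite distrC -natrB // subSS ger0_norm ?ler0n // (eqP (_ : (i - j)%N == 0%N)) //.
rewrite -natrB 1?ltnW // subSS ger0_norm ?ler0n //.
by rewrite (eqP (_ : (j - i)%N == 0%N)) ?addn0 // subn_eq0 ltnW.
Qed.

Lemma set_bij_imset {T : finType} (A B : {set T}) (s : T -> T) :
  set_bij [set` A] [set` B] s <-> {in A &, injective s} /\ s @: A = B.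
Proof.
split=> [[sAB s_inj s_surj]|[s_inj <-]].
  split=> [i j iA jA|]; first by apply: s_inj; rewrite inE.
  apply/setP => j; apply/imsetP/idP => [[i iA ->]|/s_surj[i iA <-]].
    exact: sAB.
  by exists i.
split=> [i iA|i j|_ /imsetP[i iA ->]]; first exact: imset_f.
  rewrite !inE; exact: s_inj.
by exists i.
Qed.

Lemma avg_optimal_matching_gap {R : realType} {n : nat} (A : {set 'I_(2 * n)}) :
  #|A| = n ->
  avg_optimal_matching R A = n%:R^-1 *
    ((\sum_(k < 2 * n) gap #|A :&: below k| #|finset.setC A :&: below k|)%:R /
     (2 * n + 1)%:R).
Proof.
move=> cA; congr (_ * _); set m := (X in X%:R).
have costE s : matching_cost R A s = (\sum_(i in A) gap i (s i))%:R / (2 * n + 1)%:R.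
  rewrite /matching_cost natr_sum mulr_suml.
  by apply: eq_bigr => i _; rewrite site_dist.
have cAc : #|A| = #|finset.setC A|.
  by have := cardsC A; rewrite card_ord cA; lia.
have [s [s_inj sA costs]] := sorted_matching _ _ cAc.
apply/le_anti/andP; split.
  apply: ge_inf.
    exists 0 => _ [t _ <-]; apply: sumr_ge0 => i _; exact: normr_ge0.
  exists s; first exact/set_bij_imset.
  by rewrite costE costs.
apply: lb_le_inf; first by exists (matching_cost R A s), s => //; exact/set_bij_imset.
move=> _ [t /set_bij_imset[t_inj tA] <-]; rewrite costE.
by rewrite ler_wpM2r ?invr_ge0 ?ler0n // ler_nat matching_cost_lower.
Qed.

Lemma avg_optimal_matching_ge0 {R : realType} {n : nat} (A : {set 'I_(2 * n)}) :
  0 <= avg_optimal_matching R A.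
Proof.
rewrite mulr_ge0 ?invr_ge0 ?ler0n //.
(* No bijection exists when #|A| differs from n, and then the infimum is that
   of the empty set, which is 0. *)
have [->|/set0P nz] := eqVneq (matching_cost R A @`
  [set s | set_bij [set` A] [set` finset.setC A] s]) set0; first by rewrite inf0.
apply: lb_le_inf => // _ [s _ <-]; apply: sumr_ge0 => i _; exact: normr_ge0.
Qed.

(** * The expectation *)

Lemma expectation_finite_range {R : realType} {d : measure_display}
    {T : measurableType d} (P : probability T R) {I : finType} (U : T -> I)
    (f : I -> R) :
  (forall i, measurable (U @^-1` [set i])) -> (forall i, 0 <= f i) ->
  ('E_P[f \o U] = (\sum_i f i * fine (P (U @^-1` [set i])))%:E)%E.
Proof.
move=> mU f_ge0; rewrite unlock.
have fE w : (f (U w))%:E = (\sum_i (f i)%:E * (\1_(U @^-1` [set i]) w)%:E)%E.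
  rewrite (bigD1 (U w)) //= big1 => [|i neq_i]; last first.
    rewrite indicE memNset ?mule0 //= => Uw.
    by rewrite Uw eqxx in neq_i.
  by rewrite indicE mem_set ?mule1 ?adde0.
under eq_integral => w _ do rewrite /= fE.
rewrite ge0_integral_sum //; first last.
- by move=> i w _; rewrite mule_ge0 // lee_fin.
- move=> i; apply: measurable_funeM; apply/measurable_EFinP; exact: measurable_indic.
rewrite -sumEFin; apply: eq_bigr => i _.
rewrite ge0_integralZl_EFin //; last first.
  by apply/measurable_EFinP; exact: measurable_indic.
rewrite integral_indic // setIT EFinM fineK //.
exact: fin_num_measure.
Qed.

(** The n-subsets already carry total mass 1, so every other subset has
    probability 0. *)
Lemma expectation_uniform_n_subset {R : realType} {n : nat} {d : measure_display}
    {T : measurableType d} (P : probability T R) (U : T -> {set 'I_(2 * n)})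
    (f : {set 'I_(2 * n)} -> R) :
  uniform_n_subset P U -> (forall A, 0 <= f A) ->
  ('E_P[f \o U] = ((\sum_(A : {set 'I_(2 * n)} | #|A| == n) f A) /
                    'C(2 * n, n)%:R)%:E)%E.
Proof.
move=> [mU unifU] f_ge0.
pose p A := fine (P (U @^-1` [set A])).
have p_ge0 A : 0 <= p A by rewrite fine_ge0.
have pE (A : {set 'I_(2 * n)}) : #|A| == n -> p A = 'C(2 * n, n)%:R^-1.
  by move=> /eqP cA; rewrite /p unifU.
have sum_draws : \sum_(A : {set 'I_(2 * n)} | #|A| == n) p A = 1.
  pose draws := finset (fun A : {set 'I_(2 * n)} => #|A| == n).
  have cdraws : #|draws| = 'C(2 * n, n) by rewrite card_draws card_ord.
  rewrite (eq_bigr _ pE) (eq_bigl (fun A => A \in draws)) => [|A]; last by rewrite inE.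
  rewrite sumr_const cdraws.
  by rewrite -[LHS]mulr_natl divff // pnatr_eq0 -lt0n bin_gt0; lia.
have sum_p : \sum_A p A = 1.
  have := expectation_finite_range P U (fun=> 1) mU (fun=> ler01).
  rewrite (_ : (fun=> 1) \o U = cst 1) // expectation_cst => -[->].
  by apply: eq_bigr => A _; rewrite mul1r.
have sum_rest : \sum_(A : {set 'I_(2 * n)} | #|A| != n) p A = 0.
  move: sum_p; rewrite (bigID (fun A : {set 'I_(2 * n)} => #|A| == n)) /= sum_draws.
  by move/eqP; rewrite -subr_eq0 addrAC subrr add0r => /eqP.
rewrite expectation_finite_range //; congr EFin.
rewrite (bigID (fun A : {set 'I_(2 * n)} => #|A| == n)) /= mulr_suml.
rewrite [X in _ + X]big1 ?addr0 => [|A neqA].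
  by apply: eq_bigr => A cA; rewrite -/(p A) pE.
by rewrite -/(p A) (psumr_eq0P _ sum_rest) ?mulr0.
Qed.

Lemma expected_matching {R : realType} {n : nat} {d : measure_display}
    {T : measurableType d} (P : probability T R) (U : T -> {set 'I_(2 * n)}) :
  (0 < n)%N -> uniform_n_subset P U ->
  'E_P[fun w => avg_optimal_matching R (U w)]%E =
    ((2 * n + 1)%:R^-1 * (2 ^+ (2 * n - 1) / 'C(2 * n, n)%:R))%:E.
Proof.
move=> n_gt0 unifU.
rewrite (expectation_uniform_n_subset P U (@avg_optimal_matching R n)) //; last first.
  exact: avg_optimal_matching_ge0.
congr EFin; rewrite (eq_bigr _ (fun A cA => avg_optimal_matching_gap A (eqP cA))).
rewrite -mulr_sumr -mulr_suml -natr_sum exchange_big /=.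
have card_sites : #|'I_(2 * n)| = n.*2 by rewrite card_ord mul2n.
have below_card k : (k < n.*2)%N -> #|@below (2 * n) k| = k.
  by rewrite -mul2n => /ltnW; exact: card_below.
have := sum_gap_chain _ _ card_sites below_card n_gt0.
rewrite -[n.*2]mul2n.
set S := (X in (2 * X)%N) => SE.
have -> : S%:R = n%:R * 2 ^+ (2 * n - 1) :> R.
  apply: (@mulfI _ 2%:R); first by rewrite pnatr_eq0.
  rewrite -natrM SE natrM natrX mulrCA -exprS subn1 prednK ?muln_gt0 //.
  by rewrite exprM expr2 -natrM.
field; rewrite -natrM natr1 !pnatr_eq0 -!lt0n bin_gt0 n_gt0.
by rewrite leq_pmull.
Qed.

(** * Wallis integrals *)

(** The primitive of sin^m that vanishes at 0, given by the reduction formula;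
    at pi / 2 it is the m-th Wallis integral.  Working with primitives reduces
    comparisons of integrals to signs of derivatives. *)
Fixpoint sinint {R : realType} (m : nat) (x : R) : R :=
  match m with
  | 0 => x
  | 1 => 1 - cos x
  | p.+2 => (p.+1%:R * sinint p x - sin x ^+ p.+1 * cos x) / p.+2%:R
  end.

Lemma nat_ind2 (Q : nat -> Prop) :
  Q 0%N -> Q 1%N -> (forall p, Q p -> Q p.+2) -> forall m, Q m.
Proof.
move=> Q0 Q1 QS m; suff [] : Q m /\ Q m.+1 by [].
by elim: m => [|m [Qm QSm]]; split=> //; exact: QS.
Qed.

Lemma is_derive_sinint {R : realType} (m : nat) (x : R) :
  is_derive x 1 (sinint m) (sin x ^+ m).
Proof.
elim/nat_ind2: m => [||p IHp].
- by rewrite expr0; exact: is_derive_id.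
- rewrite expr1 (_ : sinint 1 = cst 1 - cos); last by [].
  by apply: is_derive_eq; rewrite sub0r opprK.
rewrite (_ : sinint p.+2 =
  p.+2%:R^-1 \*: (p.+1%:R \*: sinint p - (sin ^+ p.+1) * cos)); last first.
  by apply/funext => y; rewrite /= !fctE mulrC.
apply: is_derive_eq.
rewrite /GRing.scale /= exprfctE.
have -> : cos x * (p.+1%:R * sin x ^+ p * cos x) =
    p.+1%:R * sin x ^+ p * (1 - sin x ^+ 2).
  by rewrite -cos2sin2; ring.
rewrite !exprS expr0; field.
by rewrite -natrD pnatr_eq0.
Qed.

Lemma sinint0 {R : realType} (m : nat) : sinint m 0 = 0 :> R.
Proof.
elim/nat_ind2: m => [||p IHp] //=; first by rewrite cos0 subrr.
by rewrite IHp sin0 expr0n /= mulr0 mul0r subrr mul0r.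
Qed.

(** The difference has derivative sin^m (1 - sin), which is nonnegative on
    [0, pi / 2]. *)
Lemma sinint_pihalf_decr {R : realType} (m : nat) :
  sinint m.+1 (pi / 2) <= sinint m (pi / 2) :> R.
Proof.
have pi2 : 0 <= pi / 2 :> R by rewrite divr_ge0 ?pi_ge0.
have D (x : R) : is_derive x 1 (sinint m - sinint m.+1) (sin x ^+ m - sin x ^+ m.+1).
  have D1 := is_derive_sinint m x; have D2 := is_derive_sinint m.+1 x.
  by apply: is_derive_eq.
have := @ger0_derive1_ndecr R (sinint m - sinint m.+1) 0 (pi / 2).
move=> /(_ _ _ _ 0 (pi / 2) (lexx _) pi2 (lexx _)) H.
rewrite -subr_ge0; apply: (le_trans _ (H _ _ _)).
- by rewrite !fctE !sinint0 subrr.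
- by move=> x _; exact: ex_derive.
- move=> x; rewrite in_itv /= => /andP[x0 x1].
  rewrite derive1E derive_val exprS -{1}[sin x ^+ m]mul1r -mulrBl.
  have := sin_gt0_pihalf (x := x); rewrite x0 x1 => /(_ isT) s0.
  by rewrite mulr_ge0 ?exprn_ge0 ?subr_ge0 ?sin_le1 // ltW.
- apply: continuous_subspaceT => x; apply: differentiable_continuous.
  by apply/derivable1_diffP; exact: ex_derive.
Qed.

Lemma sinint_pihalfSS {R : realType} (p : nat) :
  sinint p.+2 (pi / 2) = p.+1%:R / p.+2%:R * sinint p (pi / 2) :> R.
Proof. by rewrite /= cos_pihalf mulr0 subr0 mulrAC. Qed.

(** The reduction formula makes p + 1 times this product independent of p. *)
Lemma sinint_pihalf_mulS {R : realType} (p : nat) :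
  sinint p (pi / 2) * sinint p.+1 (pi / 2) = pi / 2 / p.+1%:R :> R.
Proof.
elim: p => [|p IHp]; first by rewrite /= cos_pihalf subr0 mulr1 divr1.
rewrite sinint_pihalfSS mulrCA [sinint p.+1 _ * _]mulrC IHp; field.
by rewrite nat1r -natrD !pnatr_eq0.
Qed.

Lemma sinint_pihalf_odd {R : realType} (n : nat) :
  sinint n.*2.+1 (pi / 2) = 4 ^+ n / (wbin n)%:R :> R.
Proof.
have wbin_neq0 m : (wbin m)%:R != 0 :> R.
  by rewrite pnatr_eq0 -lt0n muln_gt0 bin_gt0 -addnn leq_addr.
apply: (canRL (mulfK (wbin_neq0 n))); elim: n => [|n IHn].
  by rewrite /= cos_pihalf subr0 mulr1.
rewrite doubleS sinint_pihalfSS exprS -IHn.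
have /(congr1 (fun k : nat => k%:R : R)) := wbinS n.
rewrite (natrM _ n.+1) (natrM _ (4 * n + 6)) => wS.
rewrite -(mulKf (_ : n.+1%:R != 0) (wbin n.+1)%:R) ?wS ?pnatr_eq0 //.
rewrite -mul2n; field.
by rewrite nat1r -natrM -natrD !pnatr_eq0.
Qed.

(** Monotonicity places the square of a Wallis integral between its products
    with its two neighbours. *)
Lemma sinint_pihalf_bounds {R : realType} (n : nat) (I := sinint n.*2.+1 (pi / 2) : R) :
  pi / 2 / n.*2.+2%:R <= I ^+ 2 <= pi / 2 / n.*2.+1%:R.
Proof.
have I_ge0 : 0 <= I by rewrite /I sinint_pihalf_odd divr_ge0 ?exprn_ge0.
rewrite -!sinint_pihalf_mulS -/I expr2.
by rewrite ler_wpM2l ?ler_wpM2r ?sinint_pihalf_decr.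
Qed.

Lemma expected_matching_sinint {R : realType} (n : nat) : (0 < n)%N ->
  (2 * n + 1)%:R^-1 * (2 ^+ (2 * n - 1) / 'C(2 * n, n)%:R) =
  sinint n.*2.+1 (pi / 2) / 2 :> R.
Proof.
move=> n_gt0; rewrite sinint_pihalf_odd /wbin -mul2n natrM invfM addn1.
have -> : 4 ^+ n = 2 * 2 ^+ (2 * n - 1) :> R.
  by rewrite -exprS subn1 prednK ?muln_gt0 // exprM expr2 -natrM.
field; rewrite -natrM nat1r !pnatr_eq0 -!lt0n bin_gt0.
by rewrite leq_pmull.
Qed.

(** * The asymptotic equivalent *)

(** The bounds on the square of the Wallis integral place the square of the
    ratio between n / (n + 1) and 2n / (2n + 1); as n / (n + 1) is at most 1,
    its own square is a lower bound too. *)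
Lemma wallis_ratio_bounds {R : realType} (n : nat) : (0 < n)%N ->
  1 - n.+1%:R^-1 <=
    sinint n.*2.+1 (pi / 2 : R) / 2 / (4^-1 * Num.sqrt (pi / n%:R)) <= 1.
Proof.
move=> n_gt0; set I := sinint _ _.
have /andP[I_lo I_hi] := @sinint_pihalf_bounds R n; rewrite -/I in I_lo I_hi.
have I_ge0 : 0 <= I by rewrite /I sinint_pihalf_odd divr_ge0 ?exprn_ge0.
have n0 : 0 < n%:R :> R by rewrite ltr0n.
have pi0 : 0 < pi :> R := pi_gt0 R.
set s := Num.sqrt (pi / n%:R).
have s0 : 0 < s by rewrite sqrtr_gt0 divr_gt0.
have s2 : s ^+ 2 = pi / n%:R by rewrite sqr_sqrtr // divr_ge0 // ltW.
have -> : I / 2 / (4^-1 * s) = 2 * I / s by field; rewrite gt_eqF.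
have eS2 : n.*2.+2%:R = 2 * (n%:R + 1) :> R by rewrite -doubleS -mul2n natrM -(natr1 n).
have eS1 : n.*2.+1%:R = 2 * n%:R + 1 :> R by rewrite -(natr1 n.*2) -mul2n natrM.
have I2_lo : pi <= 4 * (n%:R + 1) * I ^+ 2.
  move: I_lo; rewrite eS2 ler_pdivrMr; last by rewrite mulr_gt0 // addr_gt0.
  lra.
have I2_hi : 2 * (2 * n%:R + 1) * I ^+ 2 <= pi.
  move: I_hi; rewrite eS1 ler_pdivlMr; last by rewrite addr_gt0 // mulr_gt0.
  lra.
have s2n : s ^+ 2 * n%:R = pi by rewrite s2 divfK ?gt_eqF.
rewrite ler_pdivlMr // ler_pdivrMr // mul1r; apply/andP; split.
  have n1 : 0 < n%:R + 1 :> R by rewrite addr_gt0.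
  rewrite -(natr1 n) (_ : 1 - (n%:R + 1)^-1 = n%:R / (n%:R + 1)); last first.
    by field; rewrite gt_eqF.
  rewrite -ler_sqr ?nnegrE; last 2 first.
  - by rewrite mulr_ge0 ?divr_ge0 // ltW.
  - by rewrite mulr_ge0.
  rewrite exprMn expr_div_n mulrAC ler_pdivrMr ?exprn_gt0 //.
  have -> : n%:R ^+ 2 * s ^+ 2 = n%:R * pi by rewrite -s2n; ring.
  have -> : (2 * I) ^+ 2 * (n%:R + 1) ^+ 2 = (n%:R + 1) * (4 * (n%:R + 1) * I ^+ 2).
    by ring.
  have : (n%:R + 1) * pi <= (n%:R + 1) * (4 * (n%:R + 1) * I ^+ 2).
    by rewrite ler_pM2l.
  lra.
rewrite -ler_sqr ?nnegrE; last 2 first.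
- by rewrite mulr_ge0.
- exact: ltW.
rewrite -(ler_pM2r n0) s2n.
have := sqr_ge0 I; lra.
Qed.

Theorem mainTheorem1 (R : realType) (d : nat -> measure_display)
    (T : forall n : nat, measurableType (d n))
    (P : forall n : nat, probability (T n) R)
    (U : forall n : nat, T n -> {set 'I_(2 * n)})
    (hU : forall n : nat, (0 < n)%N -> uniform_n_subset (P n) (U n)) :
  (forall n : nat, (0 < n)%N ->
     'E_(P n)[fun w => avg_optimal_matching R (U n w)]%E =
       ((2 * n + 1)%:R^-1 * (2 ^+ (2 * n - 1) / 'C(2 * n, n)%:R))%:E) /\
  (fine ('E_(P n)[fun w => avg_optimal_matching R (U n w)])%E /
     (4^-1 * Num.sqrt (pi / n%:R)) @[n --> \oo] --> (1 : R)).
Proof.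
have E n : (0 < n)%N -> 'E_(P n)[fun w => avg_optimal_matching R (U n w)]%E =
       ((2 * n + 1)%:R^-1 * (2 ^+ (2 * n - 1) / 'C(2 * n, n)%:R))%:E.
  by move=> n_gt0; apply: expected_matching => //; exact: hU.
split=> //.
apply: (@squeeze_cvgr _ _ _ _ (fun n => 1 - n.+1%:R^-1) (fun=> 1)).
- near=> n.
  have n_gt0 : (0 < n)%N by near: n; exact: nbhs_infty_gt.
  by rewrite E //= expected_matching_sinint // wallis_ratio_bounds.
- rewrite -[X in _ --> X]subr0; apply: cvgB; first exact: cvg_cst.
  exact: cvg_harmonic.
- exact: cvg_cst.
Unshelve. all: by end_near.
Qed.
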